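(* Let $(G,H)=(\mathrm O_n(\mathbb C),\mathrm O_m(\mathbb C)\times\mathrm O_{n-m}(\mathbb C))$ with $0<m<n$, $G_0=\mathrm{SO}_n(\mathbb C)$, $H_0=\mathrm{SO}_m(\mathbb C)\times\mathrm{SO}_{n-m}(\mathbb C)$, $0\le r\le\lfloor n/2\rfloor$, and let $S\in\mathcal O(r_U,r_W,a,b)\subseteq\mathrm{Gr}_G(r)$. The $(H\cap G_0)$-orbit of $S$ decomposes into $1$ or $2$ $H_0$-orbits. Moreover, it decomposes into $2$ $H_0$-orbits if and only if $b=0$ and at least one of the equalities $2r_U+2a+b=m$ and $2r_W+2a+b=n-m$ holds.
   Context: $V\simeq\mathbb C^n$ has a nondegenerate symmetric bilinear form $B$, $V=U\oplus W$ with $U\perp W$, $\dim U=m$, $\dim W=n-m$. $G$ is the isometry group of $V$ and $H\subset G$ the product of the isometry groups of $U$ and $W$; $G_0$, $H_0$ are the identity components of $G$, $H$. $\mathrm{Gr}_G(r)$ is the projective variety of $r$-dimensional subspaces $S$ of $V$ with $S\perp S$. For a subspace $X$, $\mathrm{Rad}(X)=X\cap X^\perp$; $\mathbf P_US=(S+W)\cap U$, $\mathbf P_WS=(S+U)\cap W$. For $S\in\mathrm{Gr}_G(r)$: $r_U(S)=\dim(S\cap U)$, $r_W(S)=\dim(S\cap W)$, $a(S)=\dim\frac{\mathrm{Rad}(\mathbf P_US)}{S\cap U}=\dim\frac{\mathrm{Rad}(\mathbf P_WS)}{S\cap W}$, $b(S)=\dim\frac{\mathbf P_US}{\mathrm{Rad}(\mathbf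 P_US)}$. The 4-tuple $(r_U(S),r_W(S),a(S),b(S))$ determines the $H$-orbit of $S$ and satisfies $2r_U+2a+b\le m$, $2r_W+2a+b\le n-m$; $\mathcal O(r_U,r_W,a,b)$ denotes the $H$-orbit with this 4-tuple. *)

(* Defs.v *)
From HB Require Import structures.
From mathcomp Require Import all_boot all_order all_algebra.
From mathcomp Require Import sesquilinear complex.
From mathcomp Require Import boolp classical_sets functions cardinality reals.

Set Implicit Arguments.
Unset Strict Implicit.
Unset Printing Implicit Defensive.

Import GRing.Theory passmx.
Local Open Scope ring_scope.
Local Open Scope classical_set_scope.
Local Open Scope card_scope.

Section Determinant.
Variables (F : fieldType) (E : vectType F).

Definition lfdet (f : 'End(E)) : F :=
  \det (mxof (vbasis {:E}) (vbasis {:E}) f).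

Lemma lfdetE (e : (\dim {:E}).-tuple E) (f : 'End(E)) :
  basis_of {:E} e -> lfdet f = \det (mxof e e f).
Proof.
move=> eb; have vb := vbasisP {:E}; rewrite /lfdet.
set v := vbasis _ in vb *.
have fE : f = (\1 \o f \o \1)%VF by rewrite comp_lfun1l comp_lfun1r.
rewrite fE (mxof_comp _ _ eb) (mxof_comp _ _ eb) !det_mulmx -fE mulrC -mulrA.
rewrite -det_mulmx -(mxof_comp _ _ vb) comp_lfun1l mxof1 ?(basis_free eb) //.
by rewrite det1 mulr1.
Qed.

End Determinant.

Section RestrictedForm.
Variables (F : fieldType) (V : vectType F) (B : {symmetric V}).
Variable X : {vspace V}.

Definition restr_form (x y : subvs_of X) : F := B (vsval x) (vsval y).

Let restr_form_linl y : GRing.linear_for *%R (restr_form ^~ y).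
Proof. by move=> c x x'; rewrite /restr_form linearP /= linearPl. Qed.

Let restr_form_linr x : GRing.linear_for (idfun \; *%R) (restr_form x).
Proof. by move=> c y y'; rewrite /restr_form !linearP. Qed.

HB.instance Definition _ :=
  bilinear_isBilinear.Build F (subvs_of X) (subvs_of X) F *%R (idfun \; *%R)
    restr_form (restr_form_linl, restr_form_linr).

Let restr_form_sym x y : restr_form x y = (-1) ^+ false * idfun (restr_form y x).
Proof. exact: hermitian_subproof. Qed.

HB.instance Definition _ :=
  isHermitianSesquilinear.Build F (subvs_of X) false idfun
    restr_form restr_form_sym.

End RestrictedForm.

Section Groups.
Variable F : fieldType.

Definition Ogrp (E : vectType F) (B : {symmetric E}) : set 'End(E) :=
  [set g : 'End(E) | isometry B B g].

Definition SOgrp (E : vectType F) (B : {symmetric E}) : set 'End(E) :=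
  [set g : 'End(E) | isometry B B g /\ lfdet g = 1].

Variable V : vectType F.
Implicit Types (B : {symmetric V}) (U W S : {vspace V}) (K : set 'End(V)).

(* K x L inside End(V), for V = U (+) W: (gU, gW) is the map equal to gU on U
   and to gW on W. *)
Definition prodgrp U W (K : set 'End(subvs_of U)) (L : set 'End(subvs_of W)) :
    set 'End(V) :=
  [set g : 'End(V) | exists gU gW, [/\ K gU, L gW,
     forall u : subvs_of U, g (vsval u) = vsval (gU u) &
     forall w : subvs_of W, g (vsval w) = vsval (gW w)]].

Definition Hgrp B U W : set 'End(V) :=
  prodgrp (Ogrp (restr_form B (X := U))) (Ogrp (restr_form B (X := W))).

Definition H0grp B U W : set 'End(V) :=
  prodgrp (SOgrp (restr_form B (X := U))) (SOgrp (restr_form B (X := W))).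

Definition vs_orbit K S : set {vspace V} := [set (g @: S)%VS | g in K].

(* When K' is a subgroup of K, the sets vs_orbit K' T below are the K'-orbits
   contained in (hence partitioning) the K-orbit of S. *)
Definition splits_into (k : nat) K' K S : Prop :=
  [set vs_orbit K' T | T in vs_orbit K S] #= `I_k.

End Groups.

Section OrbitInvariants.
Variables (F : fieldType) (V : vectType F) (B : {symmetric V}).
Implicit Types U W S X : {vspace V}.

Definition Gr (r : nat) : set {vspace V} :=
  [set S | \dim S = r /\ (S <= orthov B S)%VS].

Definition Rad X : {vspace V} := (X :&: orthov B X)%VS.

(* For V = U (+) W, the projection of S to U along W. *)
Definition projalong U W S : {vspace V} := ((S + W) :&: U)%VS.

Definition inv_r U S : nat := \dim (S :&: U).
Definition inv_a U W S : nat := (\dim (Rad (projalong U W S)) - \dim (S :&: U))%N.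
Definition inv_b U W S : nat :=
  (\dim (projalong U W S) - \dim (Rad (projalong U W S)))%N.

Definition orbitO U W (r rU rW a b : nat) : set {vspace V} :=
  [set S | [/\ Gr r S, inv_r U S = rU, inv_r W S = rW,
               inv_a U W S = a & inv_b U W S = b]].

Lemma cap_sub_Rad_proj U W S : (U <= orthov B W)%VS -> (S <= orthov B S)%VS ->
  (S :&: U <= Rad (projalong U W S))%VS.
Proof.
move=> /orthovP UW /orthovP SS; apply/subvP => x /memv_capP[xS xU].
rewrite memv_cap; apply/andP; split.
  by rewrite memv_cap xU (subvP (addvSl S W)).
apply/mem_orthovP => y /memv_capP[/memv_addP[s sS [w wW ->]] _].
by rewrite linearDr /= SS // UW // addr0.
Qed.

Let preRad U W S := (S :&: (Rad (projalong U W S) + W))%VS.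

Let dim_preRad U W S : (U :&: W = 0)%VS ->
  \dim (preRad U W S) = (\dim (Rad (projalong U W S)) + \dim (S :&: W))%N.
Proof.
move=> UW0; set R := Rad _.
have RU : (R <= U)%VS by apply: subv_trans (capvSl _ _) (capvSr _ _).
have RW0 : (R :&: W = 0)%VS.
  by apply/eqP; rewrite -subv0 -UW0; apply: capvS.
rewrite -(limg_ker_dim (daddv_pi R W) (preRad U W S)) addnC; congr (_ + _)%N.
- congr (\dim _); apply/eqP; rewrite eqEsubv; apply/andP; split.
    apply/subvP => x /memv_imgP[s /memv_capP[_ sRW] ->]; exact: memv_pi.
  apply/subvP => x xR.
  have /memv_capP[/memv_capP[/memv_addP[s sS [w wW xE]] _] _] := xR.
  have sE : s = x - w by rewrite xE addrK.
  apply/memv_imgP; exists s.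
    by rewrite memv_cap sS sE memv_add // memvN.
  rewrite sE linearB /= daddv_pi_id //.
  have := daddv_pi_add RW0 (subvP (addvSr R W) _ wW).
  by rewrite (daddv_pi_id (U := W)) 1?capvC // => /(canRL (addrK _)) ->; rewrite subrr subr0.
- congr (\dim _); apply/eqP; rewrite eqEsubv; apply/andP; split.
    apply/subvP => x /memv_capP[/memv_capP[xS xRW] /[!memv_ker] /eqP x0].
    rewrite memv_cap xS /=.
    have := daddv_pi_add RW0 xRW; rewrite x0 add0r => <-.
    exact: memv_pi.
  apply/subvP => x /memv_capP[xS xW].
  rewrite memv_cap memv_cap xS (subvP (addvSr _ _)) //= memv_ker.
  have := daddv_pi_add RW0 (subvP (addvSr R W) _ xW).
  rewrite (daddv_pi_id (U := W)) 1?capvC // => /(canRL (addrK _)) ->.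
  by rewrite subrr.
Qed.

Let preRad_sub U W S : (U + W = fullv)%VS -> (U <= orthov B W)%VS ->
  (S <= orthov B S)%VS -> (preRad U W S <= preRad W U S)%VS.
Proof.
move=> UW /orthovP oUW /orthovP SS.
have oWU w u : w \in W -> u \in U -> B w u = 0.
  by move=> wW uU; apply/eqP; rewrite herm_eq0C oUW.
apply/subvP => s /memv_capP[sS /memv_addP[u uR [w wW sE]]].
have /memv_capP[/memv_capP[_ uU] /mem_orthovP uO] := uR.
rewrite memv_cap sS sE addrC memv_add //.
have wE : w = s - u by rewrite sE addrC addKr.
rewrite memv_cap memv_cap wW wE memv_add ?memvN //=.
apply/mem_orthovP => y /memv_capP[/memv_addP[t tS [u' u'U yE]] yW].
have uyp : - u' \in projalong U W S.
  rewrite memv_cap [X in _ && X]memvN u'U andbT.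
  have -> : - u' = t - y by rewrite yE opprD addrA subrr add0r.
  by rewrite memv_add // memvN.
rewrite -wE.
have -> : B w y = B s t - B u (- u').
  have -> : t = y - u' by rewrite yE addrK.
  rewrite sE linearDl /= !linearBr /= !linearNr /= (oUW u y) // (oWU w u') //.
  by rewrite subr0 sub0r addrAC addrN add0r.
by rewrite SS // uO // subrr.
Qed.

Lemma inv_aC U W S : (U + W = fullv)%VS -> (U :&: W = 0)%VS ->
  (U <= orthov B W)%VS -> (S <= orthov B S)%VS ->
  inv_a U W S = inv_a W U S.
Proof.
move=> sUW dUW oUW SS.
have oWU : (W <= orthov B U)%VS by rewrite orthov_sym.
have : preRad U W S = preRad W U S.
  apply/eqP; rewrite eqEsubv !preRad_sub //; first by rewrite addvC.
move/(congr1 (fun X => \dim X)); rewrite !dim_preRad //; last by rewrite capvC.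
rewrite /inv_a => dimE.
have := dimvS (cap_sub_Rad_proj oUW SS); have := dimvS (cap_sub_Rad_proj oWU SS).
move=> h1 h2.
by apply/eqP; rewrite -(eqn_add2r (\dim (S :&: U) + \dim (S :&: W))) {1}addnA
  subnK // [(\dim (S :&: U) + _)%N]addnC addnA subnK // dimE.
Qed.

End OrbitInvariants.

(* Main.v *)
(* H meets G_0 in H_0 together with the coset of pairs (g_U, g_W) both of
   determinant -1, so the orbit of S splits in two exactly when no such pair
   stabilizes S.  If P_U S is not totally isotropic (b > 0), some u + w in S has
   B(u,u) = - B(w,w) <> 0 and the product of the reflections in u and w
   stabilizes S.  If b = 0 and both inequalities are strict, reflections in
   nonisotropic vectors of U orthogonal to P_U S and of W orthogonal to P_W S fix
   S pointwise.  If b = 0 and, say, 2 r_U + 2 a = m, then P_U S is a Lagrangian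
   of U, and an isometry preserving a Lagrangian has determinant 1. *)
Require Import Defs.
From HB Require Import structures.
From mathcomp Require Import all_boot all_order all_algebra.
From mathcomp Require Import sesquilinear complex.
From mathcomp Require Import boolp classical_sets functions cardinality reals.
From mathcomp Require Import ring.

Set Implicit Arguments.
Unset Strict Implicit.
Unset Printing Implicit Defensive.

Import GRing.Theory passmx.
Local Open Scope ring_scope.
Local Open Scope classical_set_scope.

(** * Determinants of endomorphisms read off in adapted bases *)

Section LinearDeterminant.
Variables (F : fieldType) (E : vectType F).
Implicit Types f g : 'End(E).

(** Row i of [M] holds the coordinates of the image of the i-th basis vector. The length [k] is kept
    apart from the dimension of [E] so that concatenated bases of length [p + q] fit. *)
Lemma lfdet_mx k (e : k.-tuple E) (M : 'M_k) f :
  basis_of {:E} e -> (forall i : 'I_k, f e`_i = \sum_j M i j *: e`_j) ->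
  lfdet f = \det M.
Proof.
move=> eb; have kE := size_basis eb; subst k => fM.
rewrite (lfdetE _ eb); congr (\det _); apply/matrixP => i j.
by rewrite !mxE /= vecof_delta fM coord_sum_free ?(basis_free eb).
Qed.

(** The span of [l] is stable under [f], so in the basis [l ++ c] the matrix is block lower
    triangular. *)
Lemma lfdet_block p q (l : p.-tuple E) (c : q.-tuple E)
    (A : 'M_p) (X : 'M_(q, p)) (D : 'M_q) f :
  basis_of {:E} (l ++ c) ->
  (forall i : 'I_p, f l`_i = \sum_j A i j *: l`_j) ->
  (forall i : 'I_q, f c`_i = \sum_j X i j *: l`_j + \sum_j D i j *: c`_j) ->
  lfdet f = \det A * \det D.
Proof.
move=> eb fl fc; rewrite -(det_lblock A X D).
have catl (i : 'I_p) : (l ++ c)`_(lshift q i) = l`_i.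
  by rewrite nth_cat size_tuple /= ltn_ord.
have catc (i : 'I_q) : (l ++ c)`_(rshift p i) = c`_i.
  by rewrite nth_cat size_tuple /= ltnNge leq_addr addKn.
apply: (lfdet_mx (e := [tuple of l ++ c])) => // i.
rewrite big_split_ord /=; case: (split_ordP i) => k ->.
  rewrite catl fl [X in _ + X]big1 ?addr0.
    by apply: eq_bigr => j _; rewrite block_mxEul catl.
  by move=> j _; rewrite block_mxEur mxE scale0r.
rewrite catc fc; congr (_ + _); apply: eq_bigr => j _.
  by rewrite block_mxEdl catl.
by rewrite block_mxEdr catc.
Qed.

Lemma lfdet_comp f g : lfdet (f \o g)%VF = lfdet f * lfdet g.
Proof. by rewrite /lfdet (mxof_comp _ _ (vbasisP _)) det_mulmx mulrC. Qed.

Lemma lfdet1 : lfdet (\1%VF : 'End(E)) = 1.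
Proof. by rewrite /lfdet mxof1 ?det1 // (basis_free (vbasisP _)). Qed.

End LinearDeterminant.

(** * Passing between a subspace and the vector space it carries *)

Lemma vsval_lker (F : fieldType) (V : vectType F) (U : {vspace V}) :
  lker (linfun (vsval : subvs_of U -> V)) = 0%VS.
Proof.
apply/eqP/lker0P => x y; rewrite !lfunE; exact: val_inj.
Qed.

Lemma vsval_limg (F : fieldType) (V : vectType F) (U : {vspace V}) :
  limg (linfun (vsval : subvs_of U -> V)) = U.
Proof.
apply/vspaceP => x; apply/memv_imgP/idP => [[u _ ->]|xU].
  by rewrite lfunE; apply: subvsP.
by exists (vsproj U x); rewrite ?memvf // lfunE /= vsprojK.
Qed.

(** Bases of U and W together form a basis of V in which [g] is block diagonal. *)
Lemma lfdet_sum (F : fieldType) (V : vectType F) (U W : {vspace V})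
    (g : 'End(V)) (gU : 'End(subvs_of U)) (gW : 'End(subvs_of W)) :
  (U + W = fullv)%VS -> (U :&: W = 0)%VS ->
  (forall u : subvs_of U, g (vsval u) = vsval (gU u)) ->
  (forall w : subvs_of W, g (vsval w) = vsval (gW w)) ->
  lfdet g = lfdet gU * lfdet gW.
Proof.
move=> sUW dUW gUE gWE.
pose bU := vbasis {:subvs_of U}; pose bW := vbasis {:subvs_of W}.
have bas (X : {vspace V}) :
    basis_of X (map (linfun (vsval : subvs_of X -> V)) (vbasis {:subvs_of X})).
  rewrite -{1}(vsval_limg X); apply: limg_basis_of (vbasisP _).
  by rewrite vsval_lker capv0.
have mx (X : {vspace V}) (h : 'End(subvs_of X)) :
  {M : 'M_(\dim {:subvs_of X}) | lfdet h = \det M &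
    forall i : 'I_(\dim {:subvs_of X}),
      h (vbasis {:subvs_of X})`_i = \sum_j M i j *: (vbasis {:subvs_of X})`_j}.
  exists (mxof (vbasis {:subvs_of X}) (vbasis {:subvs_of X}) h) => // i.
  rewrite [LHS](coord_basis (vbasisP {:subvs_of X})) ?memvf //.
  by apply: eq_bigr => j _; rewrite !mxE /= vecof_delta.
have [MU -> MUE] := mx U gU; have [MW -> MWE] := mx W gW.
pose l := [tuple of map (linfun (vsval : subvs_of U -> V)) bU].
pose c := [tuple of map (linfun (vsval : subvs_of W -> V)) bW].
have nthX (X : {vspace V}) (i : 'I_(\dim {:subvs_of X})) :
    (map (linfun (vsval : subvs_of X -> V)) (vbasis {:subvs_of X}))`_i =
    vsval (vbasis {:subvs_of X})`_i.
  by rewrite (nth_map 0) ?size_tuple // lfunE.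
apply: (@lfdet_block _ _ _ _ l c _ 0) => [|i|i].
- rewrite -sUW; apply: cat_basis (bas U) (bas W).
  exact/directv_addP.
- rewrite nthX gUE MUE linear_sum; apply: eq_bigr => j _.
  by rewrite linearZ /= nthX.
- rewrite [X in X + _]big1 ?add0r; last by move=> j _; rewrite mxE scale0r.
  rewrite nthX gWE MWE linear_sum; apply: eq_bigr => j _.
  by rewrite linearZ /= nthX.
Qed.

Lemma dim_subvs (F : fieldType) (V : vectType F) (U : {vspace V}) :
  \dim {:subvs_of U} = \dim U.
Proof. by rewrite -[in RHS](vsval_limg U) limg_dim_eq // vsval_lker capv0. Qed.

(** Lets results about a whole nondegenerate space be applied to subspaces of U with the restricted
    form. *)
Lemma dim_vsval_preim (F : fieldType) (V : vectType F) (U L : {vspace V}) :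
  (L <= U)%VS ->
  \dim (linfun (vsval : subvs_of U -> V) @^-1: L) = \dim L.
Proof.
move=> LU; rewrite -(@limg_dim_eq _ _ _ (linfun (vsval : subvs_of U -> V))).
  by rewrite lpreimK // vsval_limg.
by rewrite vsval_lker capv0.
Qed.

(** * Orthogonal complements and isotropic vectors *)

Section SymmetricForm.
Variables (F : fieldType) (E : vectType F) (B : {symmetric E}).
Implicit Types (L X Y : {vspace E}) (g h : 'End(E)).

Lemma form_symC x y : B x y = B y x.
Proof. by rewrite hermC expr0 mul1r. Qed.

Lemma formDl x y z : B (x + y) z = B x z + B y z.
Proof. exact: linearDl. Qed.
Lemma formDr x y z : B z (x + y) = B z x + B z y.
Proof. exact: linearDr. Qed.
Lemma formZl k x y : B (k *: x) y = k * B x y.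
Proof. exact: linearZl_LR. Qed.
Lemma formZr k x y : B x (k *: y) = k * B x y.
Proof. exact: linearZr_LR. Qed.
Lemma form_suml I (r : seq I) P (f : I -> E) y :
  B (\sum_(i <- r | P i) f i) y = \sum_(i <- r | P i) B (f i) y.
Proof. exact: (linear_sumlz B y r P f). Qed.
Lemma form_sumr I (r : seq I) P (f : I -> E) y :
  B y (\sum_(i <- r | P i) f i) = \sum_(i <- r | P i) B y (f i).
Proof. exact: linear_sum. Qed.

Lemma nondegP : reflect (forall x, (forall y, B x y = 0) -> x = 0)
  (nondegenerate B).
Proof.
apply: (iffP eqP) => [B0 x xB|B0].
  by apply/eqP; rewrite -memv0 -B0; apply/mem_orthovP => y _.
apply/vspaceP => x; rewrite memv0; apply/mem_orthovP/eqP => [xB|-> y _].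
  by apply: B0 => y; apply: xB; rewrite memvf.
exact: linear0l.
Qed.

(** Coordinates of the functional that x induces on X; the kernel of this linear map is the
    orthogonal of X. *)
Definition pairing_row X (x : E) : 'rV[F]_(\dim X) := \row_i B x (vbasis X)`_i.

Let pairing_row_linear X : linear (pairing_row X).
Proof. by move=> k x y; apply/rowP => i; rewrite !mxE formDl formZl. Qed.

HB.instance Definition _ X := GRing.isSemilinear.Build F _ _ _ (pairing_row X)
  (GRing.semilinear_linear (@pairing_row_linear X)).

(** Rank-nullity for [pairing_row X] on Y, whose target has dimension [\dim X]. *)
Lemma dim_cap_orthov X Y : (\dim Y <= \dim (Y :&: orthov B X) + \dim X)%N.
Proof.
pose fL := linfun (pairing_row X).
rewrite -(limg_ker_dim fL Y) leq_add //; last first.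
  by rewrite (leq_trans (dimvS (subvf _))) // dimvf dim_matrix natrME mul1n.
apply: dimvS; apply/subvP => x /memv_capP[xY].
rewrite memv_ker lfunE /= => /eqP/rowP f0.
rewrite memv_cap xY; apply/mem_orthovP => y /coord_vbasis ->.
rewrite form_sumr big1 // => i _; rewrite formZr.
by have := f0 i; rewrite !mxE => ->; rewrite mulr0.
Qed.

Lemma dim_orthov X : nondegenerate B ->
  (\dim X + \dim (orthov B X) = \dim {:E})%N.
Proof.
move=> /nondegP B0; apply/eqP; rewrite eqn_leq; apply/andP; split; last first.
  by rewrite addnC -(capfv (orthov B X)) dim_cap_orthov.
(* For the other inequality, take a complement C of the orthogonal of X. A vector of X orthogonal to
   C is orthogonal to the whole space, hence zero, so X has dimension at most that of C. *)
have := dim_cap_orthov (orthov B X)^C X.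
have -> : (X :&: orthov B (orthov B X)^C)%VS = 0%VS.
  apply/vspaceP => x; rewrite memv0; apply/idP/eqP => [|->]; last exact: mem0v.
  case/memv_capP => xX /mem_orthovP xC; apply: B0 => y.
  have := memvf y; rewrite -(addv_complf (orthov B X)).
  case/memv_addP => y1 /mem_orthovP y1X [y2 y2C ->].
  by rewrite formDr (xC y2) // form_symC y1X // addr0.
rewrite dimv0 add0n dimv_compl => h.
by rewrite addnC -leq_subRL //; apply: dimvS (subvf _).
Qed.

Lemma polarization X : (2%:R : F) != 0 -> (forall x, x \in X -> B x x = 0) ->
  (X <= orthov B X)%VS.
Proof.
move=> two0 X0; apply/orthovP => x y xX yX.
have := X0 _ (memvD xX yX).
rewrite formDl !formDr !X0 // add0r addr0 (form_symC y) -mulr2n -mulr_natl.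
by move/eqP; rewrite mulf_eq0 (negPf two0) => /eqP.
Qed.

Lemma nonisotropic_in X : (2%:R : F) != 0 -> ~~ (X <= orthov B X)%VS ->
  exists2 x, x \in X & B x x != 0.
Proof.
move=> two0 XX; apply: contrapT => nx; case/negP: XX.
apply: polarization => // x xX; apply/eqP; apply: contrapT => /negP Bx.
by apply: nx; exists x.
Qed.

(** Otherwise the orthogonal of L would be totally isotropic, hence contained in its own orthogonal,
    which has the dimension of L; the assumed inequality excludes this. *)
Lemma nonisotropic_orthov L : (2%:R : F) != 0 -> nondegenerate B ->
  (\dim L + \dim L < \dim {:E})%N -> exists2 x, x \in orthov B L & B x x != 0.
Proof.
move=> two0 B0 dL; apply: nonisotropic_in => //; apply/negP => /dimvS.
have := dim_orthov (orthov B L) B0; have := dim_orthov L B0.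
move=> d1 d2 d3; move: dL; rewrite -d1 ltn_add2l ltnNge => /negP; apply.
by rewrite -(leq_add2l (\dim (orthov B L))) [X in (_ <= X)%N]addnC d1 -d2 leq_add2l.
Qed.

(** * Isometries and their determinants *)

Lemma isometry_comp g h : isometry B B g -> isometry B B h ->
  isometry B B (g \o h)%VF.
Proof. by move=> gI hI x y; rewrite !lfunE /= gI hI. Qed.

Lemma isometry_lker g : nondegenerate B -> isometry B B g -> lker g == 0%VS.
Proof.
move=> /nondegP B0 gI; apply/lker0P => x y gxy; apply/eqP.
rewrite -subr_eq0; apply/eqP/B0 => z.
by rewrite -gI linearB /= gxy subrr linear0l.
Qed.

Lemma isometry_inv g : nondegenerate B -> isometry B B g ->
  isometry B B (g^-1)%VF.
Proof.
move=> B0 gI x y; have g0 := isometry_lker B0 gI.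
by rewrite -gI !lker0_lfunVK.
Qed.

(** A row vector killing the matrix gives a combination of [x] orthogonal to all of [y]; it
    vanishes, and freeness of [x] kills its coefficients. *)
Lemma gram_det k (x y : k.-tuple E) :
  nondegenerate B -> free x ->
  (forall z, (forall i : 'I_k, B z y`_i = 0) -> z \in <<x>>%VS -> z = 0) ->
  \det (\matrix_(i < k, j < k) B x`_i y`_j) != 0.
Proof.
move=> B0 xf xy; apply/det0P => -[v v0 vM]; case/negP: v0; apply/eqP/rowP => i.
have z0 : \sum_i v 0 i *: x`_i = 0.
  apply: xy => [j|]; last first.
    apply: memv_suml => j _; apply/memvZ/memv_span/mem_nth.
    by rewrite size_tuple.
  rewrite form_suml; have /rowP/(_ j) := vM; rewrite !mxE; apply: etrans.
  by apply: eq_bigr => a _; rewrite formZl mxE.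
by rewrite mxE (freeP xf (fun i => v 0 i) z0).
Qed.

(** With M the matrix of [g] and G the Gram matrix, M G M^T = G and det G is nonzero, so det M
    squares to 1. *)
Lemma isometry_det g : nondegenerate B -> isometry B B g ->
  lfdet g = 1 \/ lfdet g = -1.
Proof.
move=> B0 gI; set d := \dim {:E}; pose e := vbasis {:E}.
pose M : 'M_d := \matrix_(i, j) coord e j (g e`_i).
pose G : 'M_d := \matrix_(i, j) B e`_i e`_j.
have gM (i : 'I_d) : g e`_i = \sum_j M i j *: e`_j.
  rewrite [LHS](coord_vbasis (memvf _)); apply: eq_bigr => j _; by rewrite mxE.
have -> := lfdet_mx (vbasisP _) gM.
have MG : M *m G *m M^T = G.
  apply/matrixP => i j; rewrite [RHS]mxE -gI !gM form_sumr mxE.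
  apply: eq_bigr => k _; rewrite formZr form_suml !mxE mulrC; congr (_ * _).
  by apply: eq_bigr => l _; rewrite formZl [G _ _]mxE.
have G0 : \det G != 0.
  apply: (gram_det B0 (basis_free (vbasisP _))) => // z ze _.
  apply: (nondegP B0) => y; rewrite (coord_vbasis (memvf y)).
  by rewrite form_sumr big1 // => i _; rewrite formZr ze mulr0.
have /(congr1 determinant) := MG; rewrite !det_mulmx det_tr mulrAC.
rewrite -[RHS]mul1r => /(mulIf G0)/eqP; rewrite -expr2 sqrf_eq1.
by case/orP => /eqP; [left|right].
Qed.

(* In a basis adapted to L, the diagonal blocks A, D of g and the pairing P of L
   with its complement satisfy A P D^T = P. *)
Lemma isometry_Lagrangian g L : nondegenerate B -> (L <= orthov B L)%VS ->
  (\dim L + \dim L = \dim {:E})%N -> isometry B B g -> (g @: L <= L)%VS ->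
  lfdet g = 1.
Proof.
move=> B0 /orthovP LL dL gI gL; set p := \dim L.
(* The complement has the same dimension as L, which makes the pairing matrix [P] square. *)
have [c cb] : {c : p.-tuple E | basis_of L^C c}.
  have <- : \dim L^C = p by rewrite dimv_compl -dL addnK.
  by exists (vbasis _); apply: vbasisP.
pose l := vbasis L; have lb : basis_of L l := vbasisP L.
have eb : basis_of {:E} (l ++ c).
  rewrite -(addv_complf L); apply: cat_basis lb cb.
  by apply/directv_addP/capv_compl.
have lL (i : 'I_p) : l`_i \in L by apply/(basis_mem lb)/mem_nth; rewrite size_tuple.
have [A gl] : {A : 'M_p | forall i : 'I_p, g l`_i = \sum_j A i j *: l`_j}.
  exists (\matrix_(i, j) coord l j (g l`_i)) => i.
  rewrite [LHS](coord_basis lb); first by apply: eq_bigr => j _; rewrite mxE.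
  by apply: (subvP gL); apply: memv_img.
have dec x : x = \sum_i coord l i (daddv_pi L L^C x) *: l`_i +
                 \sum_i coord c i (daddv_pi L^C L x) *: c`_i.
  rewrite -(coord_basis lb) ?memv_pi // -(coord_basis cb) ?memv_pi //.
  by rewrite daddv_pi_add ?capv_compl // addv_complf memvf.
pose X : 'M_p := \matrix_(i, j) coord l j (daddv_pi L L^C (g c`_i)).
pose D : 'M_p := \matrix_(i, j) coord c j (daddv_pi L^C L (g c`_i)).
have gc (i : 'I_p) : g c`_i = \sum_j X i j *: l`_j + \sum_j D i j *: c`_j.
  rewrite {1}[g _]dec; congr (_ + _); apply: eq_bigr => j _; by rewrite mxE.
rewrite (lfdet_block eb gl gc).
pose P : 'M_p := \matrix_(i, j) B l`_i c`_j.
have APD : A *m P *m D^T = P.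
  apply/matrixP => i j; rewrite [RHS]mxE -gI gc formDr.
  (* The component of [g c_i] along L pairs to zero with [g l_i], which lies in L. *)
  rewrite [X in X + _](_ : _ = 0) ?add0r; last first.
    apply: LL; last by apply: memv_suml => k _; apply: memvZ.
    by apply: (subvP gL); apply: memv_img.
  rewrite gl form_sumr mxE.
  apply: eq_bigr => k _; rewrite formZr form_suml !mxE mulrC; congr (_ * _).
  by apply: eq_bigr => a _; rewrite formZl mxE.
(* A vector of L orthogonal to [c] is also orthogonal to L, hence to everything. *)
have P0 : \det P != 0.
  apply: (gram_det B0 (basis_free lb)) => // z zc.
  rewrite (span_basis lb) => zL; apply: (nondegP B0) => y.
  rewrite (dec y) formDr [X in X + _](_ : _ = 0) ?add0r; last first.
    by apply: LL => //; apply: memv_suml => k _; apply: memvZ.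
  by rewrite form_sumr big1 // => i _; rewrite formZr zc mulr0.
have /(congr1 determinant) := APD; rewrite !det_mulmx det_tr mulrAC.
by rewrite -[RHS]mul1r => /(mulIf P0).
Qed.

(** * Reflections, and the isometries of determinant -1 *)

Definition refl_fun u x : E := x - (2%:R * B x u / B u u) *: u.

Let refl_fun_linear u : linear (refl_fun u).
Proof.
move=> k x y; rewrite /refl_fun formDl formZl scalerBr scalerA.
by rewrite addrACA -opprD -scalerDl; congr (_ - _ *: _); ring.
Qed.

HB.instance Definition _ u := GRing.isSemilinear.Build F _ _ _ (refl_fun u)
  (GRing.semilinear_linear (@refl_fun_linear u)).

(** The orthogonal reflection sending u to -u when [B u u] is nonzero; for isotropic u the division
    by zero yields 0 and the map is the identity. *)
Definition refl u : 'End(E) := linfun (refl_fun u).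

Lemma reflE u x : refl u x = x - (2%:R * B x u / B u u) *: u.
Proof. by rewrite lfunE. Qed.

Lemma refl_orth u x : B x u = 0 -> refl u x = x.
Proof. by move=> xu; rewrite reflE xu mulr0 mul0r scale0r subr0. Qed.

Lemma isometry_refl u : B u u != 0 -> isometry B B (refl u).
Proof.
move=> u0 x y; rewrite !reflE -!scaleNr !formDl !formDr !formZl !formZr.
by rewrite (form_symC u y); field.
Qed.

(** The space is the sum of the line of u and its orthogonal, on which the map acts by -1 and by
    1. *)
Lemma lfdet_refl u : B u u != 0 -> lfdet (refl u) = -1.
Proof.
move=> u0; pose c := vbasis (orthov B <[u]>).
have un0 : u != 0 by apply: contraNneq u0 => ->; rewrite linear0l.
have eb : basis_of {:E} ([tuple u] ++ c).
  have -> : {:E}%VS = (<[u]> + orthov B <[u]>)%VS.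
    apply/eqP; rewrite eqEsubv subvf andbT; apply/subvP => x _.
    rewrite -[x](subrK ((B x u / B u u) *: u)) addrC memv_add //.
      by apply: memvZ; apply: memv_line.
    by rewrite mem_orthov1 -scaleNr formDl formZl mulNr divfK // subrr.
  apply: cat_basis (vbasisP _); last by apply: seq1_basis.
  apply/directv_addP/vspaceP => x; rewrite memv0.
  apply/memv_capP/eqP => [[/vlineP[k ->]]|->]; last by rewrite !mem0v.
  rewrite mem_orthov1 formZl mulf_eq0 (negPf u0) orbF => /eqP ->.
  by rewrite scale0r.
rewrite (@lfdet_block _ _ _ _ [tuple u] c (-1)%:M 0 1%:M) => // [|i|i].
- by rewrite det1 det_scalar1 mulr1.
- rewrite big_ord1 (ord1 i) mxE /= mulr1n reflE scaleN1r mulfK //.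
  rewrite -[X in X - _]scale1r -scalerBl -[1 - _]opprB scaleNr.
  by rewrite -[2%:R]/(1 + 1) addrK scale1r.
- rewrite big1 ?add0r => [|j _]; last by rewrite mxE scale0r.
  rewrite (bigD1 i) //= big1 ?addr0 => [|j ji].
    rewrite mxE eqxx scale1r refl_orth //; apply/eqP; rewrite -mem_orthov1.
    by apply: vbasis_mem; apply: mem_nth; rewrite size_tuple.
  by rewrite mxE eq_sym (negPf ji) scale0r.
Qed.

Definition nonspecial : set 'End(E) :=
  [set g : 'End(E) | isometry B B g /\ lfdet g = -1].

Lemma SOgrp1 : SOgrp B \1%VF.
Proof. by split; [move=> x y; rewrite !lfunE|apply: lfdet1]. Qed.

Lemma SOgrp_comp g h : SOgrp B g -> SOgrp B h -> SOgrp B (g \o h)%VF.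
Proof.
move=> [gI gd] [hI hd]; split; first exact: isometry_comp.
by rewrite lfdet_comp gd hd mulr1.
Qed.

Lemma nonspecial_comp g h : nonspecial g -> nonspecial h -> SOgrp B (g \o h)%VF.
Proof.
move=> [gI gd] [hI hd]; split; first exact: isometry_comp.
by rewrite lfdet_comp gd hd mulrNN mulr1.
Qed.

Lemma SOgrp_nonspecial_comp g h :
  SOgrp B g -> nonspecial h -> nonspecial (g \o h)%VF.
Proof.
move=> [gI gd] [hI hd]; split; first exact: isometry_comp.
by rewrite lfdet_comp gd hd mul1r.
Qed.

Lemma SOgrp_inv g : nondegenerate B -> SOgrp B g -> SOgrp B (g^-1)%VF.
Proof.
move=> B0 [gI gd]; split; first exact: isometry_inv.
have := lfdet_comp g^-1 g.
by rewrite lker0_compVf ?isometry_lker // lfdet1 gd mulr1.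
Qed.

End SymmetricForm.

(** * Products of sets of endomorphisms of the two summands *)

Section ProductGroup.
Variables (F : fieldType) (V : vectType F).
Implicit Types (U W S T : {vspace V}) (g h : 'End(V)).

Lemma prodgrp_sym U W (K : set 'End(subvs_of U)) (L : set 'End(subvs_of W)) g :
  prodgrp K L g -> prodgrp L K g.
Proof. by case=> gU [gW [? ? ? ?]]; exists gW, gU. Qed.

(** Three independent sets on each side let one lemma cover every product of special and nonspecial
    pairs. *)
Lemma prodgrp_comp U W (K1 K2 K3 : set 'End(subvs_of U))
    (L1 L2 L3 : set 'End(subvs_of W)) g h :
  (forall x y, K1 x -> K2 y -> K3 (x \o y)%VF) ->
  (forall x y, L1 x -> L2 y -> L3 (x \o y)%VF) ->
  prodgrp K1 L1 g -> prodgrp K2 L2 h -> prodgrp K3 L3 (g \o h)%VF.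
Proof.
move=> HK HL [gU [gW [KgU LgW gUE gWE]]] [hU [hW [KhU LhW hUE hWE]]].
exists (gU \o hU)%VF, (gW \o hW)%VF; split.
- exact: HK.
- exact: HL.
- by move=> u; rewrite !lfunE /= hUE gUE.
- by move=> w; rewrite !lfunE /= hWE gWE.
Qed.

End ProductGroup.

(** * The form on an orthogonal sum, and the projections of an isotropic subspace *)

Section OrthogonalSum.
Variables (F : fieldType) (V : vectType F) (B : {symmetric V}).
Implicit Types (U W S L : {vspace V}) (g : 'End(V)).

Lemma refl_vsval U (u x : subvs_of U) :
  refl B (vsval u) (vsval x) = vsval (refl (restr_form B (X := U)) u x).
Proof. by rewrite !reflE linearB linearZ. Qed.

(** A vector of U orthogonal to U is orthogonal to W as well, hence to V. *)
Lemma nondegenerate_restr U W : nondegenerate B -> (U + W = fullv)%VS ->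
  (U <= orthov B W)%VS -> nondegenerate (restr_form B (X := U)).
Proof.
move=> B0 sUW /orthovP oUW; apply/nondegP => x x0.
apply: subvs_inj; rewrite linear0; apply: (nondegP _ B0) => y.
have := memvf y; rewrite -sUW => /memv_addP[u uU [w wW ->]].
rewrite formDr (oUW _ _ (subvsP x) wW) addr0 -(vsprojK uU).
exact: x0.
Qed.

Lemma dim_isotropic U L : nondegenerate (restr_form B (X := U)) ->
  (L <= U)%VS -> (L <= orthov B L)%VS -> (\dim L + \dim L <= \dim U)%N.
Proof.
move=> BU0 LU /orthovP LL.
have := dim_orthov (linfun (vsval : subvs_of U -> V) @^-1: L)%VS BU0.
rewrite dim_vsval_preim // dim_subvs => <-.
rewrite leq_add2l -(dim_vsval_preim LU) dimvS //.
by apply/orthovP => x y; rewrite -!memv_preim !lfunE /=; apply: LL.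
Qed.

Lemma isometry_sum U W g (gU : 'End(subvs_of U)) (gW : 'End(subvs_of W)) :
  (U + W = fullv)%VS -> (U <= orthov B W)%VS ->
  isometry (restr_form B (X := U)) (restr_form B (X := U)) gU ->
  isometry (restr_form B (X := W)) (restr_form B (X := W)) gW ->
  (forall u : subvs_of U, g (vsval u) = vsval (gU u)) ->
  (forall w : subvs_of W, g (vsval w) = vsval (gW w)) -> isometry B B g.
Proof.
move=> sUW /orthovP oUW gUI gWI gUE gWE x y.
have o (u : subvs_of U) (w : subvs_of W) : B (vsval u) (vsval w) = 0.
  by apply: oUW; apply: subvsP.
have := memvf x; rewrite -sUW => /memv_addP[u uU [w wW ->]].
have := memvf y; rewrite -sUW => /memv_addP[u' u'U [w' w'W ->]].
rewrite -(vsprojK uU) -(vsprojK u'U) -(vsprojK wW) -(vsprojK w'W).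
rewrite ![g (_ + _)]linearD /= !gUE !gWE !formDl !formDr !o.
rewrite ![B (vsval (_ : subvs_of W)) (vsval (_ : subvs_of U))]form_symC !o.
congr (_ + _ + (_ + _)); [exact: gUI | exact: gWI].
Qed.

(** If w + u and w' + u' lie in S, then B(w,w') = - B(u,u'), so isotropy of one projection passes to
    the other. *)
Lemma projalong_isotropic_sym U W S : (U + W = fullv)%VS ->
  (U <= orthov B W)%VS -> (S <= orthov B S)%VS ->
  (projalong U W S <= orthov B (projalong U W S))%VS ->
  (projalong W U S <= orthov B (projalong W U S))%VS.
Proof.
move=> sUW /orthovP oUW /orthovP SS /orthovP PP.
have dec w : w \in projalong W U S ->
    exists2 u, u \in projalong U W S & w + u \in S.
  case/memv_capP => /memv_addP[s sS [u uU wE]] wW; exists (- u).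
    rewrite memv_cap [X in _ && X]memvN uU andbT.
    by rewrite (_ : - u = s - w) ?memv_add ?memvN // wE opprD addrA subrr add0r.
  by rewrite wE addrK.
apply/orthovP => w w' wP w'P.
have [u uP wuS] := dec _ wP; have [u' u'P wuS'] := dec _ w'P.
have /memv_capP[_ wW] := wP; have /memv_capP[_ w'W] := w'P.
have /memv_capP[_ uU] := uP; have /memv_capP[_ u'U] := u'P.
have := SS _ _ wuS wuS'; rewrite formDl !formDr (PP u u') // (oUW u w') //.
by rewrite (form_symC B w u') (oUW u' w) // !addr0.
Qed.

Lemma inv_b_eq0 U W S : (inv_b B U W S == 0)%N =
  (projalong U W S <= orthov B (projalong U W S))%VS.
Proof.
rewrite /inv_b /Rad subn_eq0; apply/idP/idP => [h|/capv_idPl ->] //.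
apply/capv_idPl/eqP; rewrite eqEdim capvSl; exact: h.
Qed.

(** A totally isotropic projection is its own radical; it contains [S :&: U], so the truncated
    subtraction in [inv_a] loses nothing. *)
Lemma dim_projalong U W S : (U <= orthov B W)%VS -> (S <= orthov B S)%VS ->
  (projalong U W S <= orthov B (projalong U W S))%VS ->
  \dim (projalong U W S) = (inv_r U S + inv_a B U W S)%N.
Proof.
move=> oUW SS /capv_idPl PP; rewrite /inv_r /inv_a subnKC.
  by rewrite /Rad PP.
exact/dimvS/cap_sub_Rad_proj.
Qed.

End OrthogonalSum.

(** * Orbit splitting and the stabilizer of S *)

Section Stabilizer.
Variables (F : fieldType) (V : vectType F) (B : {symmetric V}).
Variables (U W : {vspace V}).
Implicit Types (S T : {vspace V}) (g h : 'End(V)).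
Hypotheses (two0 : (2%:R : F) != 0) (B0 : nondegenerate B).
Hypotheses (sUW : (U + W = fullv)%VS) (dUW : (U :&: W = 0)%VS).
Hypothesis (oUW : (U <= orthov B W)%VS).

Local Notation BU := (restr_form B (X := U)).
Local Notation BW := (restr_form B (X := W)).
Local Notation H0 := (H0grp B U W).
Local Notation HG0 := (Hgrp B U W `&` SOgrp B).
Local Notation Hns := (prodgrp (nonspecial BU) (nonspecial BW)).

Let oWU : (W <= orthov B U)%VS. Proof. by rewrite orthov_sym. Qed.
Let sWU : (W + U = fullv)%VS. Proof. by rewrite addvC. Qed.
Let BU0 : nondegenerate BU. Proof. exact: nondegenerate_restr oUW. Qed.
Let BW0 : nondegenerate BW. Proof. exact: nondegenerate_restr oWU. Qed.
Let orthUW u w : u \in U -> w \in W -> B u w = 0.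
Proof. by move: u w; apply/orthovP. Qed.

Lemma one_neqN1 : (1 : F) <> -1.
Proof.
move=> e; case/negP: two0; apply/eqP.
by rewrite -[2%:R]/(1 + 1 : F) {1}e addNr.
Qed.

(** The determinants of the two components are signs with product 1, hence equal. *)
Lemma HG0P g : HG0 g <-> H0 g \/ Hns g.
Proof.
split=> [[[gU [gW [gUI gWI gUE gWE]]] [_ gd]]|].
  have := lfdet_sum sUW dUW gUE gWE; rewrite gd.
  have [dU|dU] := isometry_det BU0 gUI; have [dW|dW] := isometry_det BW0 gWI;
    rewrite dU dW ?mul1r ?mulr1 ?mulrNN => e.
  - by left; exists gU, gW.
  - by case: one_neqN1.
  - by case: one_neqN1.
  - by right; exists gU, gW.
by case=> -[gU [gW [[gUI dU] [gWI dW] gUE gWE]]]; split;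
  do ?[by exists gU, gW]; (split; [exact: isometry_sum gUE gWE
    | by rewrite (lfdet_sum sUW dUW gUE gWE) dU dW ?mulrNN mulr1]).
Qed.

Lemma H0_1 : H0 \1%VF.
Proof.
by exists \1%VF, \1%VF; split; rewrite ?lfunE; do ?exact: SOgrp1;
  move=> x; rewrite !lfunE.
Qed.

Lemma H0_inv g : H0 g -> exists2 h, H0 h & (h \o g = \1)%VF.
Proof.
move=> Hg; have [_ [gI _]] : HG0 g by apply/HG0P; left.
have g0 := isometry_lker B0 gI; exists g^-1%VF; last exact: lker0_compVf.
case: Hg => gU [gW [gUS gWS gUE gWE]].
exists gU^-1%VF, gW^-1%VF; split; try exact: SOgrp_inv.
- move=> u; apply: (lker0P g0).
  by rewrite gUE !lker0_lfunVK // (isometry_lker _ gUS.1).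
- move=> w; apply: (lker0P g0).
  by rewrite gWE !lker0_lfunVK // (isometry_lker _ gWS.1).
Qed.

Lemma orbit_H0 h S : H0 h -> vs_orbit H0 (h @: S)%VS = vs_orbit H0 S.
Proof.
move=> Hh; have [k Hk kh] := H0_inv Hh.
apply/seteqP; split=> _ [g Hg <-].
  by exists (g \o h)%VF; rewrite ?limg_comp //; apply: (prodgrp_comp _ _ Hg Hh);
    apply: SOgrp_comp.
exists (g \o k)%VF; first by apply: (prodgrp_comp _ _ Hg Hk); apply: SOgrp_comp.
by rewrite -limg_comp -comp_lfunA kh comp_lfun1r.
Qed.

(** For [k] nonspecial, k S = (k g) S with [k \o g] in [H0], so every translate of S lies in the
    [H0]-orbit of S. *)
Lemma splits_into1 g S : Hns g -> (g @: S)%VS = S -> splits_into 1 H0 HG0 S.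
Proof.
move=> Hg gS; rewrite /splits_into.
rewrite (_ : [set _ | _ in _] = [set vs_orbit H0 S]) ?card_set1 //.
apply/seteqP; split=> [_ [_ [k /HG0P Hk <-]] <-|_ ->]; last first.
  exists S => //; exists \1%VF; last exact: lim1g.
  by apply/HG0P; left; exact: H0_1.
case: Hk => Hk; first exact: orbit_H0.
rewrite /= -{1}gS -limg_comp orbit_H0 //.
by apply: (prodgrp_comp _ _ Hk Hg); apply: nonspecial_comp.
Qed.

Lemma splits_into2 t S : Hns t -> (forall g, Hns g -> (g @: S)%VS <> S) ->
  splits_into 2 H0 HG0 S.
Proof.
move=> Ht nS; apply/eq_cardSP.
exists (vs_orbit H0 S).
  exists S => //; exists \1%VF; last exact: lim1g.
  by apply/HG0P; left; exact: H0_1.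
rewrite (_ : _ `\` _ = [set vs_orbit H0 (t @: S)%VS]) ?card_set1 //.
have mem_orbit T : vs_orbit H0 T T.
  by exists \1%VF; [exact: H0_1|exact: lim1g].
apply/seteqP; split=> [_ [[_ [k /HG0P Hk <-] <-] kS]|_ ->] /=.
  case: Hk => Hk; first by case: kS; apply: orbit_H0.
  (* With [m] inverse to t t, k = (k m t) t and [k m t] is in [H0]; hence k S is in the [H0]-orbit
     of t S. *)
  have Htt : H0 (t \o t)%VF by apply: (prodgrp_comp _ _ Ht Ht); apply: nonspecial_comp.
  have [m Hm mtt] := H0_inv Htt.
  have -> : (k @: S)%VS = ((k \o (m \o t)) @: (t @: S))%VS.
    by rewrite -limg_comp -!comp_lfunA mtt comp_lfun1r.
  apply: orbit_H0; apply: (prodgrp_comp _ _ Hk _); try exact: nonspecial_comp.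
  by apply: (prodgrp_comp _ _ Hm Ht); apply: SOgrp_nonspecial_comp.
split; first by exists (t @: S)%VS => //; exists t => //; apply/HG0P; right.
(* If the two orbits agreed, some [h \o t] with [h] in [H0] would be a nonspecial pair stabilizing
   S. *)
move=> e; have := mem_orbit S; rewrite -e => -[h Hh].
rewrite -limg_comp; apply: nS.
by apply: (prodgrp_comp _ _ Hh Ht); apply: SOgrp_nonspecial_comp.
Qed.

Lemma refl_pair (u : subvs_of U) (w : subvs_of W) : BU u u != 0 -> BW w w != 0 ->
  Hns (refl B (vsval u) \o refl B (vsval w))%VF.
Proof.
move=> u0 w0; exists (refl BU u), (refl BW w); split.
- by split; [exact: isometry_refl|exact: lfdet_refl].
- by split; [exact: isometry_refl|exact: lfdet_refl].
- move=> x; rewrite lfunE /= (@refl_orth _ _ _ (vsval w)) ?refl_vsval //.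
  by rewrite orthUW ?subvsP.
- move=> x; rewrite lfunE /= refl_vsval refl_orth //.
  by rewrite form_symC orthUW ?subvsP.
Qed.

(** Isometries of a nondegenerate form are injective, so mapping S into itself already gives
    equality. *)
Lemma refl_pair_stable S u w : u \in U -> w \in W -> B u u != 0 -> B w w != 0 ->
  (forall s, s \in S -> refl B u (refl B w s) \in S) ->
  exists2 g, Hns g & (g @: S)%VS = S.
Proof.
move=> uU wW u0 w0 uwS; exists (refl B u \o refl B w)%VF.
  by have := @refl_pair (vsproj U u) (vsproj W w); rewrite /restr_form !vsprojK //; apply.
apply/eqP; rewrite eqEdim; apply/andP; split.
  by apply/subvP => _ /memv_imgP[s sS ->]; rewrite lfunE; apply: uwS.
rewrite limg_dim_eq // (eqP (isometry_lker B0 _)) ?capv0 //.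
by apply: isometry_comp; apply: isometry_refl.
Qed.

(* For u + w in S, the vectors u and w have opposite squares and opposite
   pairings with the components of any element of S, so the two reflections
   together subtract a multiple of u + w. *)
Lemma stabilizer_anisotropic S : (S <= orthov B S)%VS ->
  ~~ (projalong U W S <= orthov B (projalong U W S))%VS ->
  exists2 g, Hns g & (g @: S)%VS = S.
Proof.
move=> /orthovP SS /(nonisotropic_in two0)[u].
case/memv_capP => /memv_addP[s sS [w0 w0W uE]] uU Bu.
(* The sign makes [u + w] equal to the vector [s] of S projecting to u. *)
pose w := - w0; have wW : w \in W by rewrite memvN.
have uwS : u + w \in S by rewrite uE addrK.
have Bw : B w w = - B u u.
  have := SS _ _ uwS uwS.
  rewrite formDl !formDr (orthUW uU wW) (form_symC B w u) (orthUW uU wW).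
  by rewrite addr0 add0r => /eqP; rewrite addrC addr_eq0 => /eqP.
apply: (refl_pair_stable uU wW Bu); first by rewrite Bw oppr_eq0.
move=> x xS; have Bxw : B x w = - B x u.
  by apply/eqP; rewrite -addr_eq0 addrC -formDr SS.
rewrite !reflE Bxw Bw -!scaleNr formDl formZl.
rewrite (form_symC B w u) (orthUW uU wW) mulr0 addr0.
rewrite -addrA memvD //.
rewrite (_ : 2%:R * - B x u / - B u u = 2%:R * B x u / B u u); last first.
  by rewrite invrN !(mulrN, mulNr) opprK.
by rewrite -scalerDr memvZ // addrC.
Qed.

Lemma stabilizer_isotropic S :
  (\dim (projalong U W S) + \dim (projalong U W S) < \dim U)%N ->
  (\dim (projalong W U S) + \dim (projalong W U S) < \dim W)%N ->
  exists2 g, Hns g & (g @: S)%VS = S.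
Proof.
have ex X Y : nondegenerate (restr_form B (X := X)) ->
    (\dim (projalong X Y S) + \dim (projalong X Y S) < \dim X)%N ->
    exists x, [/\ x \in X, B x x != 0 & {in projalong X Y S, forall y, B y x = 0}].
  move=> BX0 dX; set P := projalong X Y S in dX *.
  have PX : (P <= X)%VS by exact: capvSr.
  have := @nonisotropic_orthov _ _ _
    (linfun (vsval : subvs_of X -> V) @^-1: P)%VS two0 BX0.
  rewrite dim_vsval_preim // => -[|x /mem_orthovP xP Bx].
    by rewrite dim_subvs.
  exists (vsval x); split; [exact: subvsP|exact: Bx|move=> y yP].
  rewrite form_symC -(vsprojK (subvP PX _ yP)); apply: (xP (vsproj X y)).
  by rewrite -memv_preim lfunE /= vsprojK ?(subvP PX).
move=> /(ex _ _ BU0)[u [uU Bu uP]] /(ex _ _ BW0)[w [wW Bw wP]].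
apply: (refl_pair_stable uU wW Bu Bw) => s sS.
have := memvf s; rewrite -sUW => /memv_addP[x xU [y yW sE]].
(* The components of [s] lie in the two projections, so both reflections fix [s]. *)
have xP : x \in projalong U W S.
  by rewrite memv_cap xU andbT (_ : x = s - y) ?memv_add ?memvN // sE addrK.
have yP : y \in projalong W U S.
  by rewrite memv_cap yW andbT (_ : y = s - x) ?memv_add ?memvN // sE addrC addKr.
have su : B s u = 0 by rewrite sE formDl uP // form_symC (orthUW uU yW) addr0.
have sw : B s w = 0 by rewrite sE formDl (orthUW xU wW) add0r wP.
by rewrite (refl_orth sw) (refl_orth su).
Qed.

Lemma stabilizer_Lagrangian S g :
  (projalong U W S <= orthov B (projalong U W S))%VS ->
  (\dim (projalong U W S) + \dim (projalong U W S) = \dim U)%N ->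
  Hns g -> (g @: S)%VS <> S.
Proof.
set P := projalong U W S => /orthovP PP dP [gU [gW [[gUI gUd] _ gUE gWE]]] gS.
have PU : (P <= U)%VS by exact: capvSr.
apply: one_neqN1; rewrite -gUd; symmetry.
apply: (@isometry_Lagrangian _ _ BU _
  (linfun (vsval : subvs_of U -> V) @^-1: P)%VS) => //.
- apply/orthovP => x y; rewrite -!memv_preim !lfunE /= => xP yP; exact: PP.
- by rewrite dim_vsval_preim // dP dim_subvs.
(* Since [g] preserves both S and W, its restriction to U preserves (S + W) intersected with U, a
   Lagrangian of U. *)
apply/subvP => _ /memv_imgP[x + ->].
rewrite -!memv_preim !lfunE /= => /memv_capP[/memv_addP[s sS [w wW xE]] _].
rewrite memv_cap subvsP andbT -gUE xE linearD memv_add //=.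
  by have := memv_img g sS; rewrite gS.
by rewrite -(vsprojK wW) gWE subvsP.
Qed.

End Stabilizer.

(** * Counting the orbits from b and the dimensions of the two projections *)

Theorem theorem4p10 (R : realType) (n m : nat) (V : vectType R[i])
  (B : {symmetric V}) (U W : {vspace V})
  (hm : (0 < m < n)%N)
  (hV : \dim {:V} = n)
  (hB : nondegenerate B)
  (hsum : (U + W)%VS = fullv) (hdirect : (U :&: W)%VS = 0%VS)
  (horth : (U <= orthov B W)%VS)
  (hU : \dim U = m) (hW : \dim W = (n - m)%N)
  (r rU rW a b : nat) (hr : (r <= n./2)%N)
  (S : {vspace V}) (hS : orbitO B U W r rU rW a b S) :
  let H0 := H0grp B U W in
  let HG0 := Hgrp B U W `&` SOgrp B in
  (splits_into 1 H0 HG0 S \/ splits_into 2 H0 HG0 S) /\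
  (splits_into 2 H0 HG0 S <->
     b = 0%N /\ ((2 * rU + 2 * a + b = m)%N \/ (2 * rW + 2 * a + b = n - m)%N)).
Proof.
move=> H0 HG0; case/andP: hm => m0 mn.
have two0 : (2%:R : R[i]) != 0 by rewrite Num.Theory.pnatr_eq0.
have horth' : (W <= orthov B U)%VS by rewrite orthov_sym.
have hsum' : (W + U = fullv)%VS by rewrite addvC.
case: hS => -[_ SS] rUE rWE aE bE.
have one_not_two : splits_into 1 H0 HG0 S -> ~ splits_into 2 H0 HG0 S.
  move=> s1 s2.
  by have /card_eq_II := card_eq_trans (card_esym s1) s2.
have [g Hg] : exists g,
    prodgrp (nonspecial (restr_form B (X := U))) (nonspecial (restr_form B (X := W))) g.
  (* The zero subspace has zero projections, and U and W are nonzero, so a nonspecial pair exists;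
     it supplies the candidate second orbit. *)
  have [||g Hg _] := @stabilizer_isotropic _ _ _ U W two0 hB hsum horth 0%VS;
    last by exists g.
  - by rewrite /projalong add0v capvC hdirect dimv0 hU.
  - by rewrite /projalong add0v hdirect dimv0 hW subn_gt0.
set P := projalong U W S; set Q := projalong W U S.
have [PP|PP] := boolP (P <= orthov B P)%VS; last first.
  have [k Hk kS] := stabilizer_anisotropic two0 hB horth SS PP.
  have s1 : splits_into 1 H0 HG0 S := splits_into1 two0 hB hsum hdirect horth Hk kS.
  split; first by left.
  split=> [/(one_not_two s1)//|[b0 _]]; case/negP: PP.
  by rewrite -inv_b_eq0 bE b0.
have QQ : (Q <= orthov B Q)%VS := projalong_isotropic_sym hsum horth SS PP.
have b0 : b = 0%N by apply/eqP; rewrite -bE inv_b_eq0.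
have dP : \dim P = (rU + a)%N by rewrite (dim_projalong horth) // rUE aE.
(* The invariant a is defined from the U side; its symmetry in U and W is what allows it here. *)
have dQ : \dim Q = (rW + a)%N by rewrite (dim_projalong horth') // rWE -inv_aC // aE.
have dimP : (\dim P + \dim P <= m)%N.
  rewrite -hU; apply: dim_isotropic PP; last exact: capvSr.
  exact: nondegenerate_restr horth.
have dimQ : (\dim Q + \dim Q <= n - m)%N.
  rewrite -hW; apply: dim_isotropic QQ; last exact: capvSr.
  exact: nondegenerate_restr horth'.
(* As b = 0, the two numerical equalities say exactly that [P] is Lagrangian in U, respectively [Q]
   in W. *)
have eP : (2 * rU + 2 * a + b)%N = (\dim P + \dim P)%N.
  by rewrite b0 addn0 -mulnDr -dP mul2n addnn.
have eQ : (2 * rW + 2 * a + b)%N = (\dim Q + \dim Q)%N.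
  by rewrite b0 addn0 -mulnDr -dQ mul2n addnn.
rewrite eP eQ; have split_in_2 := splits_into2 two0 hB hsum hdirect horth Hg.
have [eqP|neP] := eqVneq (\dim P + \dim P)%N m.
  have s2 : splits_into 2 H0 HG0 S.
    apply: split_in_2 => h.
    by apply: (stabilizer_Lagrangian two0 hB hsum horth PP); rewrite hU.
  by split; [right | split=> // _; split; last left].
have [eqQ|neQ] := eqVneq (\dim Q + \dim Q)%N (n - m)%N.
  have s2 : splits_into 2 H0 HG0 S.
    apply: split_in_2 => h /prodgrp_sym.
    by apply: (stabilizer_Lagrangian two0 hB hsum' horth' QQ); rewrite hW.
  by split; [right | split=> // _; split; last right].
(* Neither projection is Lagrangian, so both dimension bounds are strict. *)
have [||k Hk kS] := stabilizer_isotropic two0 hB hsum horth (S := S).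
- by rewrite hU ltn_neqAle neP.
- by rewrite hW ltn_neqAle neQ.
have s1 : splits_into 1 H0 HG0 S := splits_into1 two0 hB hsum hdirect horth Hk kS.
split; first by left.
split=> [/(one_not_two s1)//|[_ [e|e]]]; first by rewrite e eqxx in neP.
by rewrite e eqxx in neQ.
Qed.
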